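(* Let $X$ be an infinite discrete proper metric space, and let $\Omega$ be the set of all free ultrafilters on $X$. Then the set $\{\tau_\omega:\omega\in\Omega\}$ is dense in $\widehat X^c$.
   Context: Let $(X,d_X)$ be a metric space. Write $x$ for $(x,0)$ and $x'$ for $(x,1)$ in $X\times\{0,1\}$. $\mathcal M(X)$ is the set of all metrics $d$ on $X\times\{0,1\}$ whose restriction to each copy of $X$ equals $d_X$ and with $\inf_{x,y\in X}d(x,y')>0$. Metrics $d_1,d_2\in\mathcal M(X)$ are coarse equivalent if there exist monotone functions $\varphi,\psi:[0,\infty)\to[0,\infty)$ tending to $\infty$ at $\infty$ with $\varphi(d_1(x,y'))\le d_2(x,y')\le\psi(d_1(x,y'))$ for all $x,y\in X$. $M^c(X)$ is the set of classes $[d]_c$; it is an inverse semigroup under $[\rho]_c[d]_c=[\rho d]_c$, $(\rho d)(x,y')=\inf_{z\in X}[d(x,z')+\rho(z,y')]$. $E(M^c(X))$ is its set of idempotents; each idempotent class has a selfadjoint representative ($d(x,y')=d(y,x')$) and is determined by the coarse equivalence class of the function $x\mapsto d(x,x')$ (positive functions $f,g$ on $X$ are coarse equivalent if there exist monotone functions $\varphi,\psi:[0,\infty)\to[0,\infty)$ tending to $\infty$ at $\infty$ with $\varphi(f(x))\le g(x)\le\psi(f(x))$ for all $x\in X$). $E(M^c(X))$ is a distributive lattice: for $p=[d_1]_c$, $q=[d_2]_c$ with $d_i$ selfadjoint, $p\land q=pq$ and $p\lor q$ are the idempotents whose functions are coarse equivalent to $x\mapsto\max(d_1(x,x'),d_2(x,x'))$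 and $x\mapsto\min(d_1(x,x'),d_2(x,x'))$, respectively. The minimal element $\mathbf 0$ is the class of $d_X(x,x_0)+1+d_X(x_0,y)$ (any $x_0\in X$); the maximal element $\mathbf 1$ is represented by $d_X(x,y)+1$. $\widehat X^c$ is the Stone space of the Boolean algebra generated by $E(M^c(X))$; it is identified with the set $\mathrm{Hom}(E(M^c(X)),\mathbb Z/2)$ of lattice homomorphisms to the two-element Boolean algebra preserving $\mathbf 0$ and $\mathbf 1$, with the topology of pointwise convergence, i.e. with pre-base $U_e^i=\{\varphi:\varphi(e)=i\}$, $e\in E(M^c(X))$, $i=0,1$. For a free ultrafilter $\omega$ on $X$ and $A\subset X$ put $\omega(A)=1$ if $A\in\omega$ and $\omega(A)=0$ otherwise. For $s\in E(M^c(X))$ take a selfadjoint $d\in s$, set $A_n=\{x\in X:d(x,x')\le n\}$, and define $\tau_\omega(s)=\lim_{n\to\infty}\omega(A_n)$; this does not depend on $d$, and $\tau_\omega\in\widehat X^c$. *)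

(* Defs.v *)
From HB Require Import structures.
From mathcomp Require Import all_boot all_order all_algebra.
From mathcomp Require Import generic_quotient.
From mathcomp Require Import all_classical all_reals all_analysis.
From mathcomp Require Import lra.

Set Implicit Arguments.
Unset Strict Implicit.
Unset Printing Implicit Defensive.

Import Order.TTheory GRing.Theory Num.Theory.
Import numFieldTopology.Exports.

Local Open Scope classical_set_scope.
Local Open Scope ring_scope.
Local Open Scope quotient_scope.

Section Coarse.
Context {R : realType}.

(* Only the values on [0, +oo[ of a control function matter. *)
Definition control (phi : R -> R) : Prop :=
  [/\ forall t, 0 <= t -> 0 <= phi t,
      forall s t, 0 <= s -> s <= t -> phi s <= phi t
    & phi t @[t --> +oo] --> +oo].

Definition coarse_equiv (I : Type) (f g : I -> R) : Prop :=
  exists phi psi, [/\ control phi, control psi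
    & forall i, phi (f i) <= g i <= psi (f i)].

Definition bounds (I : Type) (f g : I -> R) : Prop :=
  forall r, exists s, forall i, f i <= r -> g i <= s.

Lemma control_gt phi A : control phi -> exists2 M, 0 <= M &
  forall t, M <= t -> A < phi t.
Proof.
move=> [_ _ /cvgryPgt /(_ A)] [M [_ hM]].
exists (Num.max 0 (M + 1)); first by rewrite le_max lexx.
move=> t; rewrite ge_max => /andP[_ Mt]; apply: hM.
by rewrite (lt_le_trans _ Mt)// ltrDl.
Qed.

Lemma upper_control (I : Type) (f g : I -> R) : (forall i, 0 <= f i) ->
  bounds f g -> exists2 psi, control psi & forall i, g i <= psi (f i).
Proof.
move=> f0 fg.
pose A t := [set x | x = 0 \/ exists2 i, f i <= t & x = g i].
have A0 t : A t 0 by left.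
have supA t : has_sup (A t).
  split; first by exists 0.
  have [s hs] := fg t; exists (Num.max 0 s) => x [->|[i /hs gi ->]].
    by rewrite le_max lexx.
  by rewrite le_max gi orbT.
have sup0 t : 0 <= sup (A t) by apply: sup_upper_bound.
exists (fun t => sup (A t) + t); last first.
  move=> i; rewrite -[g i]addr0 lerD//.
  by apply: sup_upper_bound; [exact: supA|right; exists i].
split.
- by move=> t t0; rewrite addr_ge0.
- move=> s t s0 st; rewrite lerD//; apply: ge_sup; first by exists 0.
  move=> x Ax; apply: sup_upper_bound => //.
  by case: Ax => [->|[i fi ->]]; [left|right; exists i => //; apply: le_trans st].
- apply/cvgryPge => B; near=> t; rewrite -[B]add0r lerD//.
Unshelve. all: by end_near. Qed.

Lemma lower_control (I : Type) (f g : I -> R) psi : (forall i, 0 <= g i) ->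
  control psi -> (forall i, f i <= psi (g i)) ->
  exists2 phi, control phi & forall i, phi (f i) <= g i.
Proof.
move=> g0 cpsi fg; have [psi0 psim _] := cpsi.
pose A t := [set s | 0 <= s /\ t <= psi s].
have A0 t : A t !=set0.
  have [M M0 hM] := control_gt t cpsi.
  by exists M; split => //; apply/ltW/hM.
have lbA t : has_lbound (A t) by exists 0 => s [].
exists (fun t => inf (A t)); last by move=> i; apply: ge_inf.
split.
- by move=> t _; apply: lb_le_inf => // s [].
- move=> s t s0 st; apply: lb_le_inf => // x [x0 tx].
  by apply: ge_inf => //; split => //; apply: le_trans tx.
- apply/cvgryPge => B; near=> t; apply: lb_le_inf => // x [x0 tx].
  have [//|xB] := leP B x.
  have : psi x <= psi B by apply: psim => //; exact: ltW.
  rewrite leNgt => /negP; case; apply: lt_le_trans tx.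
  by near: t; apply: nbhs_pinfty_gt; rewrite num_real.
Unshelve. all: by end_near. Qed.

Lemma coarse_equivP (I : Type) (f g : I -> R) :
  (forall i, 0 <= f i) -> (forall i, 0 <= g i) ->
  coarse_equiv f g <-> bounds f g /\ bounds g f.
Proof.
move=> f0 g0; split=> [[phi [psi [cphi cpsi h]]]|[fg gf]].
  split=> r.
    have [_ psim _] := cpsi.
    exists (psi (Num.max r 0)) => i fr; have /andP[_ /le_trans ->//] := h i.
    by apply: psim => //; rewrite le_max fr.
  have [M M0 hM] := control_gt r cphi; exists M => i gr.
  rewrite leNgt; apply/negP => /ltW /hM; rewrite ltNge => /negP; apply.
  by have /andP[/le_trans + _] := h i; apply.
have [psi cpsi hpsi] := upper_control f0 fg.
have [psi' cpsi' hpsi'] := upper_control g0 gf.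
have [phi cphi hphi] := lower_control g0 cpsi' hpsi'.
by exists phi, psi; split => // i; rewrite hphi hpsi.
Qed.

Lemma bounds_refl (I : Type) (f : I -> R) : bounds f f.
Proof. by move=> r; exists r. Qed.

Lemma bounds_trans (I : Type) (f g h : I -> R) :
  bounds f g -> bounds g h -> bounds f h.
Proof.
by move=> fg gh r; have [s fgs] := fg r; have [t ght] := gh s;
  exists t => i /fgs /ght.
Qed.

End Coarse.

Fact EMc_display : Order.disp_t.
Proof. exact: Order.Disp tt tt. Qed.

Section CoarseMetrics.
Context {R : realType} (X : metricType R).
Implicit Types x y z u : X.

Definition is_metric (T : Type) (d : T -> T -> R) : Prop :=
  [/\ forall a b, 0 <= d a b,
      forall a b, d a b = 0 <-> a = b,
      forall a b, d a b = d b a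
    & forall a b c, d a c <= d a b + d b c].

(* The copy (x, 0) is (x, false) and the copy (x, 1) is (x, true). *)
Record cmetric := CMetric {
  cm_dist :> X * bool -> X * bool -> R;
  cm_metric : is_metric cm_dist;
  cm_restrict : forall i x y, cm_dist (x, i) (y, i) = mdist x y;
  cm_inf_gt0 :
    (0 < ereal_inf [set (cm_dist (xy.1, false) (xy.2, true))%:E
                   | xy in [set: X * X]])%E }.

HB.instance Definition _ := gen_eqMixin cmetric.
HB.instance Definition _ := gen_choiceMixin cmetric.

Definition cross (d : cmetric) x y : R := d (x, false) (y, true).
Arguments cross : simpl never.

Definition coarse_eq (d1 d2 : cmetric) : Prop :=
  coarse_equiv (fun xy => cross d1 xy.1 xy.2) (fun xy => cross d2 xy.1 xy.2).

Definition selfadjoint (d : cmetric) : Prop :=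
  forall x y, cross d x y = cross d y x.

Definition diag (d : cmetric) x : R := cross d x x.

Let dX := @mdist R X.

(* A metric in M(X) amounts to a cross function satisfying [is_cross]. *)
Record is_cross (g : X -> X -> R) : Prop := IsCross {
  cross_tril : forall x z y, g x y <= dX x z + g z y;
  cross_trir : forall x z y, g x y <= g x z + dX z y;
  cross_disl : forall x y z, dX x y <= g x z + g y z;
  cross_disr : forall x y z, dX x y <= g z x + g z y;
  cross_low : exists2 e, 0 < e & forall x y, e <= g x y }.

Definition glue (g : X -> X -> R) (a b : X * bool) : R :=
  match a.2, b.2 with
  | false, true => g a.1 b.1
  | true, false => g b.1 a.1
  | _, _ => dX a.1 b.1
  end.

Lemma glue_metric g : is_cross g -> is_metric (glue g).
Proof.
move=> [tl tr dl dr [e e0 he]].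
have g0 x y : 0 < g x y by apply: lt_le_trans (he x y).
have dC : forall x y, dX x y = dX y x by exact: metric_sym.
split.
- by move=> [x []] [y []]; rewrite /glue/= ?mdist_ge0// ltW.
- move=> [x []] [y []]; rewrite /glue/=; split.
  + by move/mdist_positivity => ->.
  + by move=> [->]; rewrite /dX mdistxx.
  + by move=> h; have := g0 y x; rewrite h ltxx.
  + by case.
  + by move=> h; have := g0 x y; rewrite h ltxx.
  + by case.
  + by move/mdist_positivity => ->.
  + by move=> [->]; rewrite /dX mdistxx.
- by move=> [x []] [y []]; rewrite /glue/= // dC.
- move=> [x []] [y []] [z []]; rewrite /glue/=.
  + exact: metric_triangle.
  + by rewrite addrC dC tr.
  + exact: dr.
  + by rewrite addrC (le_trans (tl _ y _))// lerD2r dC.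
  + exact: tr.
  + exact: dl.
  + exact: tl.
  + exact: metric_triangle.
Qed.

Lemma glue_restrict g i x y : glue g (x, i) (y, i) = dX x y.
Proof. by case: i. Qed.

Lemma glue_inf_gt0 g : is_cross g ->
  (0 < ereal_inf [set (glue g (xy.1, false) (xy.2, true))%:E
                 | xy in [set: X * X]])%E.
Proof.
move=> [_ _ _ _ [e e0 he]]; apply: (@lt_le_trans _ _ e%:E).
  by rewrite lte_fin.
by apply: le_ereal_inf_tmp => _ [xy _ <-]; rewrite lee_fin; apply: he.
Qed.

Definition cmetric_of g (gP : is_cross g) : cmetric :=
  CMetric (glue_metric gP) (@glue_restrict g) (glue_inf_gt0 gP).

Lemma cross_is_cross (d : cmetric) : is_cross (cross d).
Proof.
have [d0 dP dC dT] := cm_metric d; split.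
- by move=> x z y; rewrite /dX -(cm_restrict d false); apply: dT.
- by move=> x z y; rewrite /dX -(cm_restrict d true); apply: dT.
- move=> x y z; rewrite /dX -(cm_restrict d false) /cross [X in _ + X]dC.
  exact: dT.
- move=> x y z; rewrite /dX -(cm_restrict d true) /cross [X in X + _]dC.
  exact: dT.
- have := cm_inf_gt0 d; set A := [set _ | _ in _] => A0.
  have ub xy : (ereal_inf A <= (cross d xy.1 xy.2)%:E)%E.
    by apply: ereal_inf_lbound; exists xy.
  move: A0 ub; case: (ereal_inf A) => [e| |]//.
    by rewrite lte_fin => e0 ub; exists e => // x y;
      rewrite -lee_fin; exact: (ub (x, y)).
  by move=> _ ub; exists 1 => // x y; have := ub (x, y).
Qed.

Lemma cross_gt0 d x y : 0 < cross d x y.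
Proof.
by have [_ _ _ _ [e e0 he]] := cross_is_cross d; apply: lt_le_trans (he x y).
Qed.

Lemma cross_ge0 d x y : 0 <= cross d x y.
Proof. exact/ltW/cross_gt0. Qed.

Lemma coarse_eqP d1 d2 : coarse_eq d1 d2 <->
  bounds (fun xy => cross d1 xy.1 xy.2) (fun xy => cross d2 xy.1 xy.2) /\
  bounds (fun xy => cross d2 xy.1 xy.2) (fun xy => cross d1 xy.1 xy.2).
Proof. by apply: coarse_equivP => i; exact: cross_ge0. Qed.

Definition coarse_eqb (d1 d2 : cmetric) : bool := `[< coarse_eq d1 d2 >].

Lemma coarse_eqb_refl : reflexive coarse_eqb.
Proof. by move=> d; apply/asboolP/coarse_eqP; split; apply: bounds_refl. Qed.

Lemma coarse_eqb_sym : symmetric coarse_eqb.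
Proof. by move=> d e; apply/asboolP/asboolP; rewrite !coarse_eqP; case. Qed.

Lemma coarse_eqb_trans : transitive coarse_eqb.
Proof.
move=> e d f /asboolP/coarse_eqP[h1 h2] /asboolP/coarse_eqP[h3 h4].
by apply/asboolP/coarse_eqP; split; [apply: bounds_trans h3|apply: bounds_trans h2].
Qed.

Canonical coarse_equiv_rel :=
  EquivRel coarse_eqb coarse_eqb_refl coarse_eqb_sym coarse_eqb_trans.

Definition Mc : Type := {eq_quot coarse_equiv_rel}.
HB.instance Definition _ := Choice.on Mc.
HB.instance Definition _ := EqQuotient.on Mc.

Definition cclass (d : cmetric) : Mc := \pi_Mc d.

Lemma cclassK (p : Mc) : cclass (repr p) = p.
Proof. exact: reprK. Qed.

Lemma Mc_eqP d1 d2 : cclass d1 = cclass d2 <-> coarse_eq d1 d2.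
Proof.
rewrite /cclass; split=> [/eqP|h]; first by rewrite eqmodE => /asboolP.
by apply/eqP; rewrite eqmodE; apply/asboolP.
Qed.

Definition comp_fun (rho d : cmetric) x y : R :=
  inf (range (fun z => cross d x z + cross rho z y)).

Section CompFun.
Variables rho d : cmetric.

Let A x y := range (fun z => cross d x z + cross rho z y).

Let A0 x y : A x y !=set0.
Proof. by eexists; exists x. Qed.

Let lbA x y : has_lbound (A x y).
Proof. by exists 0 => _ [z _ <-]; rewrite addr_ge0// cross_ge0. Qed.

Lemma comp_fun_le z x y : comp_fun rho d x y <= cross d x z + cross rho z y.
Proof. by apply: (ge_inf (lbA x y)); exists z. Qed.

Lemma le_comp_fun c x y : (forall z, c <= cross d x z + cross rho z y) ->
  c <= comp_fun rho d x y.
Proof. by move=> h; apply: (lb_le_inf (A0 x y)) => _ [z _ <-]. Qed.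

Lemma comp_fun_near r x y : comp_fun rho d x y <= r ->
  exists2 z, cross d x z <= r + 1 & cross rho z y <= r + 1.
Proof.
move=> h; have /(inf_lt (A0 x y)) : comp_fun rho d x y < r + 1.
  by rewrite (le_lt_trans h)// ltrDl.
move=> [_ [z _ <-]] hz; exists z.
  by have := cross_ge0 rho z y; lra.
by have := cross_ge0 d x z; lra.
Qed.

Lemma comp_fun_is_cross : is_cross (comp_fun rho d).
Proof.
have [dtl dtr ddl ddr [e e0 he]] := cross_is_cross d.
have [rtl rtr rdl rdr _] := cross_is_cross rho.
have dC : forall x y, dX x y = dX y x by exact: metric_sym.
split.
- move=> x z y; rewrite -lerBlDl; apply: le_comp_fun => u; rewrite lerBlDl.
  by have := comp_fun_le u x y; have := dtl x z u; lra.
- move=> x z y; rewrite -lerBlDr; apply: le_comp_fun => u; rewrite lerBlDr.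
  by have := comp_fun_le u x y; have := rtr u z y; lra.
- move=> x y z; rewrite -lerBlDr; apply: le_comp_fun => u.
  rewrite lerBlDr -lerBlDl; apply: le_comp_fun => v; rewrite lerBlDl.
  have := ddl x y u; have := rdl u v z; have := dtr y v u; rewrite [dX v u]dC.
  by lra.
- move=> x y z; rewrite -lerBlDr; apply: le_comp_fun => u.
  rewrite lerBlDr -lerBlDl; apply: le_comp_fun => v; rewrite lerBlDl.
  have := ddr u v z; have := rdr x y u; have := rtl u v y.
  by lra.
- exists e => // x y; apply: le_comp_fun => z.
  by have := he x z; have := cross_ge0 rho z y; lra.
Qed.

Definition comp : cmetric := cmetric_of comp_fun_is_cross.

End CompFun.

Lemma comp_bounds rho rho' d d' :
  bounds (fun xy => cross rho xy.1 xy.2) (fun xy => cross rho' xy.1 xy.2) ->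
  bounds (fun xy => cross d xy.1 xy.2) (fun xy => cross d' xy.1 xy.2) ->
  bounds (fun xy => cross (comp rho d) xy.1 xy.2)
         (fun xy => cross (comp rho' d') xy.1 xy.2).
Proof.
move=> hr hd r; have [s hs] := hr (r + 1); have [t ht] := hd (r + 1).
exists (t + s) => -[x y] /comp_fun_near[z dz rz].
by apply: le_trans (comp_fun_le rho' d' z x y) _; rewrite lerD//;
  [exact: (ht (x, z))|exact: (hs (z, y))].
Qed.

Definition Mc_mul (p q : Mc) : Mc := cclass (comp (repr p) (repr q)).

Lemma Mc_mul_pi rho d : Mc_mul (cclass rho) (cclass d) = cclass (comp rho d).
Proof.
have reprE e : coarse_eq (repr (cclass e)) e by apply/Mc_eqP; rewrite cclassK.
have /coarse_eqP[h1 h2] := reprE rho; have /coarse_eqP[h3 h4] := reprE d.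
by apply/Mc_eqP/coarse_eqP; split; apply: comp_bounds.
Qed.

Definition Mc_idem : pred Mc := fun p => Mc_mul p p == p.

Record EMc := EMcOf { EMc_val :> Mc; EMc_idem : Mc_idem EMc_val }.
HB.instance Definition _ := [isSub for EMc_val].
HB.instance Definition _ := [Choice of EMc by <:].


Lemma idem_bounds d : Mc_idem (cclass d) -> forall r, exists s, forall x y,
  cross d x y <= r -> diag d x <= s /\ dX x y <= s.
Proof.
move=> /eqP; rewrite Mc_mul_pi => /Mc_eqP/coarse_eqP[_ hd] r.
have [t ht] := hd r.
have [tl tr dl dr _] := cross_is_cross d.
exists (2 * r + 2 * (t + 1)) => x y xy.
have /comp_fun_near[/= z xz zy] := ht (x, y) xy.
have := tr x z x; have := dl x z y; have := dr z y x.
have : dX x y <= dX x z + dX z y by exact: metric_triangle.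
have : dX z x = dX x z by exact: metric_sym.
have := cross_ge0 d x y; have := cross_ge0 d x z; have := cross_ge0 d z y.
by rewrite /diag; split; lra.
Qed.

Lemma diag_lip d x y : diag d x <= diag d y + 2 * dX x y.
Proof.
have [tl tr _ _ _] := cross_is_cross d.
have := tl x y x; have := tr y y x.
have : dX y x = dX x y by exact: metric_sym.
by rewrite /diag; lra.
Qed.

Lemma diag_ge0 d x : 0 <= diag d x.
Proof. exact: cross_ge0. Qed.

Lemma diag_low d : exists2 e, 0 < e & forall x, e <= diag d x.
Proof. by have [_ _ _ _ [e e0 he]] := cross_is_cross d; exists e => // x; exact: he. Qed.

Lemma cross_le_diag d x y : cross d x y <= diag d x + dX x y.
Proof. by have [_ tr _ _ _] := cross_is_cross d; exact: tr. Qed.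

Definition beq (f g : X -> R) := bounds f g /\ bounds g f.

Lemma beq_refl f : beq f f.
Proof. by split; exact: bounds_refl. Qed.

Lemma beq_sym f g : beq f g -> beq g f.
Proof. by case. Qed.

Lemma beq_trans f g h : beq f g -> beq g h -> beq f h.
Proof.
by move=> [a b] [c e]; split; [exact: bounds_trans c|exact: bounds_trans b].
Qed.

Lemma coarse_eq_diag d1 d2 : coarse_eq d1 d2 -> beq (diag d1) (diag d2).
Proof.
move=> /coarse_eqP[h1 h2]; split=> r.
  by have [s hs] := h1 r; exists s => x /(hs (x, x)).
by have [s hs] := h2 r; exists s => x /(hs (x, x)).
Qed.

Lemma diag_coarse_eq d1 d2 : Mc_idem (cclass d1) -> Mc_idem (cclass d2) ->
  beq (diag d1) (diag d2) -> coarse_eq d1 d2.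
Proof.
have half e1 e2 : Mc_idem (cclass e1) -> bounds (diag e1) (diag e2) ->
    bounds (fun xy => cross e1 xy.1 xy.2) (fun xy => cross e2 xy.1 xy.2).
  move=> i1 h r; have [s hs] := idem_bounds i1 r; have [t ht] := h s.
  exists (t + s) => -[x y] /hs[/ht xt xys].
  by apply: le_trans (cross_le_diag _ _ _) _; rewrite lerD.
by move=> i1 i2 [h1 h2]; apply/coarse_eqP; split; apply: half.
Qed.

(* By [diagP] and [diag_bump], these are exactly the functions x |-> d(x, x')
   with d in M(X). *)
Record is_diag (f : X -> R) : Prop := IsDiag {
  diag_lipP : forall x y, f x <= f y + 2 * dX x y;
  diag_lowP : exists2 e, 0 < e & forall x, e <= f x }.

Lemma diagP d : is_diag (diag d).
Proof. by split; [exact: diag_lip|exact: diag_low]. Qed.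

Lemma is_diag_max f g : is_diag f -> is_diag g ->
  is_diag (fun x => Num.max (f x) (g x)).
Proof.
move=> [fl [e e0 fe]] [gl _]; split.
  move=> x y; rewrite ge_max; have := fl x y; have := gl x y.
  have : f y <= Num.max (f y) (g y) by rewrite le_max lexx.
  have : g y <= Num.max (f y) (g y) by rewrite le_max lexx orbT.
  by move=> ? ? ? ?; apply/andP; split; lra.
by exists e => // x; rewrite le_max fe.
Qed.

Lemma is_diag_min f g : is_diag f -> is_diag g ->
  is_diag (fun x => Num.min (f x) (g x)).
Proof.
move=> [fl [e e0 fe]] [gl [e' e'0 ge]]; split.
  move=> x y; rewrite -lerBlDr le_min; have := fl x y; have := gl x y.
  have : Num.min (f x) (g x) <= f x by rewrite ge_min lexx.
  have : Num.min (f x) (g x) <= g x by rewrite ge_min lexx orbT.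
  by move=> ? ? ? ?; apply/andP; split; lra.
exists (Num.min e e'); first by rewrite lt_min e0.
by move=> x; rewrite le_min !ge_min fe ge orbT.
Qed.

(* A selfadjoint idempotent metric with prescribed function x |-> d(x, x'). *)
Definition bump_fun (f : X -> R) x y : R := Num.max (dX x y) ((f x + f y) / 2).

Lemma bump_is_cross f : is_diag f -> is_cross (bump_fun f).
Proof.
move=> [fl [e e0 fe]].
have dC : forall x y, dX x y = dX y x by exact: metric_sym.
have dT : forall x y z, dX x z <= dX x y + dX y z by exact: metric_triangle.
have m1 x y : dX x y <= bump_fun f x y by rewrite le_max lexx.
have m2 x y : (f x + f y) / 2 <= bump_fun f x y by rewrite le_max lexx orbT.
split.
- move=> x z y; rewrite ge_max; apply/andP; split.
    by apply: le_trans (dT x z y) _; rewrite lerD2l.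
  by have := fl x z; have := m2 z y; lra.
- move=> x z y; rewrite ge_max; apply/andP; split.
    by apply: le_trans (dT x z y) _; rewrite lerD2r.
  by have := fl y z; rewrite [dX y z]dC; have := m2 x z; lra.
- move=> x y z; apply: le_trans (dT x z y) _; rewrite [dX z y]dC.
  by rewrite lerD.
- move=> x y z; apply: le_trans (dT x z y) _; rewrite [dX x z]dC.
  by rewrite lerD.
- exists e => // x y; apply: le_trans (m2 x y).
  by have := fe x; have := fe y; lra.
Qed.

Definition bump f (fP : is_diag f) : cmetric := cmetric_of (bump_is_cross fP).

Lemma cross_bump f (fP : is_diag f) x y :
  cross (bump fP) x y = Num.max (dX x y) ((f x + f y) / 2).
Proof. by []. Qed.

Lemma bump_selfadjoint f (fP : is_diag f) : selfadjoint (bump fP).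
Proof.
move=> x y; rewrite !cross_bump [f x + _]addrC.
by have -> : dX x y = dX y x by exact: metric_sym.
Qed.

Lemma diag_bump f (fP : is_diag f) : diag (bump fP) = f.
Proof.
apply/funext => x; have [_ [e e0 fe]] := fP; have := fe x => fx.
rewrite /diag cross_bump /dX mdistxx max_r; first by lra.
by lra.
Qed.

Lemma bump_le f (fP : is_diag f) r x y : cross (bump fP) x y <= r ->
  [/\ dX x y <= r, f x <= 2 * r & f y <= 2 * r].
Proof.
rewrite cross_bump ge_max => /andP[? ?].
by have [_ [e e0 fe]] := fP; have := fe x; have := fe y; split => //; lra.
Qed.

Lemma le_bump f (fP : is_diag f) r x y :
  dX x y <= r -> f x <= r -> f y <= r -> cross (bump fP) x y <= r.
Proof. by rewrite cross_bump ge_max => -> ? ? /=; lra. Qed.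

Lemma bump_idem f (fP : is_diag f) : Mc_idem (cclass (bump fP)).
Proof.
have dT : forall x y z, dX x z <= dX x y + dX y z by exact: metric_triangle.
rewrite /Mc_idem Mc_mul_pi; apply/eqP/Mc_eqP/coarse_eqP; split=> r.
  exists (2 * (r + 1)) => -[x y] /comp_fun_near[/= z /bump_le[xz fx _]].
  move=> /bump_le[zy _ fy]; apply: le_bump => //.
  by have := dT x z y; lra.
exists (2 * r + r) => -[x y] /= h.
apply: le_trans (comp_fun_le _ _ x x y) _; apply: lerD => //.
by rewrite -/(diag _ x) diag_bump; have [] := bump_le h.
Qed.

Lemma comp_idem d1 d2 : Mc_idem (cclass d1) -> Mc_idem (cclass d2) ->
  coarse_eq (comp d1 d2) (bump (is_diag_max (diagP d1) (diagP d2))).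
Proof.
move=> i1 i2.
have dT : forall x y z, dX x z <= dX x y + dX y z by exact: metric_triangle.
have dC : forall x y, dX x y = dX y x by exact: metric_sym.
apply/coarse_eqP; split=> r.
  have [s1 hs1] := idem_bounds i1 (r + 1).
  have [s2 hs2] := idem_bounds i2 (r + 1).
  exists (3 * (s1 + s2)) => -[x y] /comp_fun_near[/= z /hs2[xs xz] /hs1[zs zy]].
  have := dT x z y; have := diag_lip d1 x z; have := diag_lip d1 y z.
  have := diag_lip d2 z x; have := diag_lip d2 y z.
  rewrite [dX z x]dC [dX y z]dC.
  have := diag_ge0 d1 z; have := diag_ge0 d2 x.
  have : 0 <= dX x z by exact: mdist_ge0.
  have : 0 <= dX z y by exact: mdist_ge0.
  by move=> *; apply: le_bump; rewrite ?ge_max; try (apply/andP; split); lra.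
exists (2 * r + 2 * r + r) => -[x y] /= /bump_le[xy + _].
rewrite ge_max => /andP[x1 x2].
apply: le_trans (comp_fun_le _ _ x x y) _.
by have := cross_le_diag d1 x y; move: x1 x2 xy; rewrite /diag; lra.
Qed.

Lemma EMc_selfadjoint (p : EMc) : exists2 d, selfadjoint d & cclass d = p.
Proof.
exists (bump (diagP (repr (EMc_val p)))); first exact: bump_selfadjoint.
rewrite -[RHS]cclassK; apply/Mc_eqP/diag_coarse_eq.
- exact: bump_idem.
- by rewrite cclassK; exact: EMc_idem.
- by rewrite diag_bump; exact: beq_refl.
Qed.

Definition sa_rep (p : EMc) : cmetric := s2val (cid2 (EMc_selfadjoint p)).

Lemma sa_rep_selfadjoint p : selfadjoint (sa_rep p).
Proof. exact: (s2valP (cid2 (EMc_selfadjoint p))). Qed.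

Lemma pi_sa_rep p : cclass (sa_rep p) = p.
Proof. exact: (s2valP' (cid2 (EMc_selfadjoint p))). Qed.

Definition pdiag p := diag (sa_rep p).

Lemma pdiagE (p : EMc) d : cclass d = p -> beq (diag d) (pdiag p).
Proof. by move=> h; apply/coarse_eq_diag/Mc_eqP; rewrite h pi_sa_rep. Qed.

Lemma EMc_eqP (p q : EMc) : beq (pdiag p) (pdiag q) -> p = q.
Proof.
move=> h; apply: val_inj; rewrite /= -(pi_sa_rep p) -(pi_sa_rep q).
by apply/Mc_eqP/diag_coarse_eq => //; rewrite pi_sa_rep; exact: EMc_idem.
Qed.

Lemma diag_coarse_equivP (f g : X -> R) : is_diag f -> is_diag g ->
  coarse_equiv f g <-> beq f g.
Proof.
move=> [_ [e e0 fe]] [_ [e' e'0 ge]].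
by apply: coarse_equivP => x; [apply: le_trans (fe x)|apply: le_trans (ge x)];
  exact: ltW.
Qed.

Lemma Mc_mul_sa_rep (p q : EMc) : Mc_mul p q =
  cclass (bump (is_diag_max (diagP (sa_rep p)) (diagP (sa_rep q)))).
Proof.
rewrite -[in LHS](pi_sa_rep p) -[in LHS](pi_sa_rep q) Mc_mul_pi.
by apply/Mc_eqP/comp_idem; rewrite pi_sa_rep; exact: EMc_idem.
Qed.

Lemma EMc_meet_subproof (p q : EMc) : Mc_idem (Mc_mul p q).
Proof. by rewrite Mc_mul_sa_rep; exact: bump_idem. Qed.

Definition EMc_meet (p q : EMc) : EMc := EMcOf (EMc_meet_subproof p q).

Lemma pdiag_meet p q :
  beq (pdiag (EMc_meet p q)) (fun x => Num.max (pdiag p x) (pdiag q x)).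
Proof.
have := pdiagE (esym (Mc_mul_sa_rep p q) : _ = EMc_meet p q :> Mc).
by rewrite diag_bump; exact: beq_sym.
Qed.

Lemma beq_max f f' g g' : beq f f' -> beq g g' ->
  beq (fun x => Num.max (f x) (g x)) (fun x => Num.max (f' x) (g' x)).
Proof.
have half (a b a' b' : X -> R) : bounds a a' -> bounds b b' -> bounds
    (fun x => Num.max (a x) (b x)) (fun x => Num.max (a' x) (b' x)).
  move=> ha hb r; have [s hs] := ha r; have [t ht] := hb r.
  exists (Num.max s t) => x; rewrite !ge_max => /andP[/hs h1 /ht h2].
  by rewrite !le_max h1 h2 orbT.
by move=> [? ?] [? ?]; split; apply: half.
Qed.

Lemma beq_min f f' g g' : beq f f' -> beq g g' ->
  beq (fun x => Num.min (f x) (g x)) (fun x => Num.min (f' x) (g' x)).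
Proof.
have half (a b a' b' : X -> R) : bounds a a' -> bounds b b' -> bounds
    (fun x => Num.min (a x) (b x)) (fun x => Num.min (a' x) (b' x)).
  move=> ha hb r; have [s hs] := ha r; have [t ht] := hb r.
  exists (Num.max s t) => x; rewrite !ge_min => /orP[/hs h1|/ht h2].
    by rewrite le_max h1.
  by rewrite !le_max h2 !orbT.
by move=> [? ?] [? ?]; split; apply: half.
Qed.

Definition is_join (p q r : EMc) : Prop := forall d1 d2 d,
  selfadjoint d1 -> selfadjoint d2 -> selfadjoint d ->
  cclass d1 = p -> cclass d2 = q -> cclass d = r ->
  coarse_equiv (diag d) (fun x => Num.min (diag d1 x) (diag d2 x)).

Lemma is_joinP p q r : is_join p q r <->
  beq (pdiag r) (fun x => Num.min (pdiag p x) (pdiag q x)).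
Proof.
split=> [h|h d1 d2 d _ _ _ e1 e2 e].
  apply/diag_coarse_equivP; [exact: diagP|apply: is_diag_min; exact: diagP|].
  by apply: h; rewrite ?pi_sa_rep//; exact: sa_rep_selfadjoint.
apply/diag_coarse_equivP; [exact: diagP|apply: is_diag_min; exact: diagP|].
apply: beq_trans (pdiagE e) _; apply: beq_trans h _.
by apply: beq_min; apply/beq_sym/pdiagE.
Qed.

Lemma is_join_exists p q : exists r, is_join p q r.
Proof.
have fP := is_diag_min (diagP (sa_rep p)) (diagP (sa_rep q)).
exists (EMcOf (bump_idem fP)); apply/is_joinP.
have := @pdiagE (EMcOf (bump_idem fP)) (bump fP) erefl.
by rewrite diag_bump; exact: beq_sym.
Qed.

Lemma is_join_unique p q r r' : is_join p q r -> is_join p q r' -> r = r'.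
Proof.
move=> /is_joinP h /is_joinP h'; apply: EMc_eqP.
by apply: beq_trans h _; exact: beq_sym.
Qed.

Definition EMc_join (p q : EMc) : EMc := sval (cid (is_join_exists p q)).

Lemma EMc_joinP p q : is_join p q (EMc_join p q).
Proof. exact: (svalP (cid (is_join_exists p q))). Qed.

Lemma pdiag_join p q :
  beq (pdiag (EMc_join p q)) (fun x => Num.min (pdiag p x) (pdiag q x)).
Proof. exact/is_joinP/EMc_joinP. Qed.

Lemma EMc_meetP (p q : EMc) d1 d2 d :
  cclass d1 = p -> cclass d2 = q -> cclass d = EMc_meet p q ->
  coarse_equiv (diag d) (fun x => Num.max (diag d1 x) (diag d2 x)).
Proof.
move=> e1 e2 e.
apply/diag_coarse_equivP; [exact: diagP|apply: is_diag_max; exact: diagP|].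
apply: beq_trans (pdiagE e) _; apply: beq_trans (pdiag_meet _ _) _.
by apply: beq_max; apply/beq_sym/pdiagE.
Qed.

Let meetC : commutative EMc_meet.
Proof.
move=> p q; apply: EMc_eqP; apply: beq_trans (pdiag_meet _ _) _.
apply: beq_sym; apply: beq_trans (pdiag_meet _ _) _.
by under eq_fun do rewrite maxC; exact: beq_refl.
Qed.

Let joinC : commutative EMc_join.
Proof.
move=> p q; apply: EMc_eqP; apply: beq_trans (pdiag_join _ _) _.
apply: beq_sym; apply: beq_trans (pdiag_join _ _) _.
by under eq_fun do rewrite minC; exact: beq_refl.
Qed.

Let pdiag_meet3 p q r : beq (pdiag (EMc_meet p (EMc_meet q r)))
  (fun x => Num.max (pdiag p x) (Num.max (pdiag q x) (pdiag r x))).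
Proof.
apply: beq_trans (pdiag_meet _ _) _.
by apply: beq_max; [exact: beq_refl|exact: pdiag_meet].
Qed.

Let pdiag_join3 p q r : beq (pdiag (EMc_join p (EMc_join q r)))
  (fun x => Num.min (pdiag p x) (Num.min (pdiag q x) (pdiag r x))).
Proof.
apply: beq_trans (pdiag_join _ _) _.
by apply: beq_min; [exact: beq_refl|exact: pdiag_join].
Qed.

Let meetA : associative EMc_meet.
Proof.
move=> p q r; rewrite [RHS]meetC; apply: EMc_eqP.
apply: beq_trans (pdiag_meet3 _ _ _) _; apply: beq_sym.
apply: beq_trans (pdiag_meet3 _ _ _) _.
by under eq_fun do rewrite maxC -maxA; exact: beq_refl.
Qed.

Let joinA : associative EMc_join.
Proof.
move=> p q r; rewrite [RHS]joinC; apply: EMc_eqP.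
apply: beq_trans (pdiag_join3 _ _ _) _; apply: beq_sym.
apply: beq_trans (pdiag_join3 _ _ _) _.
by under eq_fun do rewrite minC -minA; exact: beq_refl.
Qed.

Let joinKI q p : EMc_meet p (EMc_join p q) = p.
Proof.
apply: EMc_eqP; apply: beq_trans (pdiag_meet _ _) _.
apply: beq_trans (beq_max (beq_refl _) (pdiag_join _ _)) _.
by under eq_fun do rewrite minKx; exact: beq_refl.
Qed.

Let meetKU q p : EMc_join p (EMc_meet p q) = p.
Proof.
apply: EMc_eqP; apply: beq_trans (pdiag_join _ _) _.
apply: beq_trans (beq_min (beq_refl _) (pdiag_meet _ _)) _.
by under eq_fun do rewrite maxKx; exact: beq_refl.
Qed.

Let meetUl : left_distributive EMc_meet EMc_join.
Proof.
move=> p q r; apply: EMc_eqP; apply: beq_trans (pdiag_meet _ _) _.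
apply: beq_trans (beq_max (pdiag_join _ _) (beq_refl _)) _.
apply: beq_sym; apply: beq_trans (pdiag_join _ _) _.
apply: beq_trans (beq_min (pdiag_meet _ _) (pdiag_meet _ _)) _.
by under eq_fun do rewrite -max_minl; exact: beq_refl.
Qed.

Let meetxx : idempotent_op EMc_meet.
Proof. by move=> p; apply: val_inj; exact/eqP/EMc_idem. Qed.

Let EMc_le (p q : EMc) := EMc_meet p q == p.
Let EMc_lt (p q : EMc) := (q != p) && EMc_le p q.

HB.instance Definition _ := @Order.isMeetJoinDistrLattice.Build EMc_display EMc
  EMc_le EMc_lt EMc_meet EMc_join (fun _ _ => erefl) (fun _ _ => erefl)
  meetC joinC meetA joinA joinKI meetKU meetUl meetxx.

Definition zero_fun x0 x y : R := dX x x0 + 1 + dX x0 y.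

Lemma zero_is_cross x0 : is_cross (zero_fun x0).
Proof.
have dC : forall x y, dX x y = dX y x by exact: metric_sym.
have dT : forall x y z, dX x z <= dX x y + dX y z by exact: metric_triangle.
have d0 : forall x y, 0 <= dX x y by exact: mdist_ge0.
rewrite /zero_fun; split.
- by move=> x z y; have := dT x z x0; lra.
- by move=> x z y; have := dT x0 z y; lra.
- by move=> x y z; have := dT x x0 y; rewrite [dX x0 y]dC; have := d0 x0 z; lra.
- by move=> x y z; have := dT x x0 y; rewrite [dX x x0]dC; have := d0 z x0; lra.
- by exists 1 => // x y; have := d0 x x0; have := d0 x0 y; lra.
Qed.

Definition zero_metric x0 : cmetric := cmetric_of (zero_is_cross x0).

Lemma zero_idem x0 : Mc_idem (cclass (zero_metric x0)).
Proof.
have d0 : forall x y, 0 <= dX x y by exact: mdist_ge0.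
have zE x y : cross (zero_metric x0) x y = dX x x0 + 1 + dX x0 y by [].
rewrite /Mc_idem Mc_mul_pi; apply/eqP/Mc_eqP/coarse_eqP; split=> r.
  exists r => -[x y] /=; apply: le_trans; apply: le_comp_fun => z.
  by rewrite !zE; have := d0 x0 z; have := d0 z x0; lra.
exists (r + 1) => -[x y] /= h.
apply: le_trans (comp_fun_le _ _ x0 x y) _.
by move: h; rewrite !zE /dX mdistxx; lra.
Qed.

Definition EMc0 x0 : EMc := EMcOf (zero_idem x0).

Definition one_fun x y : R := dX x y + 1.

Lemma one_is_cross : is_cross one_fun.
Proof.
have dC : forall x y, dX x y = dX y x by exact: metric_sym.
have dT : forall x y z, dX x z <= dX x y + dX y z by exact: metric_triangle.
rewrite /one_fun; split.
- by move=> x z y; have := dT x z y; lra.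
- by move=> x z y; have := dT x z y; lra.
- by move=> x y z; have := dT x z y; rewrite [dX z y]dC; lra.
- by move=> x y z; have := dT x z y; rewrite [dX x z]dC; lra.
- by exists 1 => // x y; rewrite lerDr; exact: mdist_ge0.
Qed.

Definition one_metric : cmetric := cmetric_of one_is_cross.

Lemma one_idem : Mc_idem (cclass one_metric).
Proof.
have dT : forall x y z, dX x z <= dX x y + dX y z by exact: metric_triangle.
have oE x y : cross one_metric x y = dX x y + 1 by [].
rewrite /Mc_idem Mc_mul_pi; apply/eqP/Mc_eqP/coarse_eqP; split=> r.
  exists r => -[x y] /=; apply: le_trans; apply: le_comp_fun => z.
  by rewrite !oE; have := dT x z y; lra.
exists (r + 1) => -[x y] /= h.
apply: le_trans (comp_fun_le _ _ x x y) _.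
by move: h; rewrite !oE /dX mdistxx; lra.
Qed.

Definition EMc1 : EMc := EMcOf one_idem.

Lemma EMc0_le x0 (p : EMc) : (EMc0 x0 <= p)%O.
Proof.
apply/eqP/EMc_eqP; apply: beq_trans (pdiag_meet _ _) _.
have e := @pdiagE (EMc0 x0) (zero_metric x0) erefl.
apply: beq_trans (beq_trans (beq_max (beq_sym e) (beq_refl _)) _) e.
have d0 : forall x y, 0 <= dX x y by exact: mdist_ge0.
have zE x : diag (zero_metric x0) x = dX x x0 + 1 + dX x0 x by [].
split=> r; first by exists r => x; rewrite ge_max => /andP[].
exists (Num.max r (pdiag p x0 + 2 * r)) => x h.
rewrite ge_max !le_max h /=; apply/orP; right.
have := diag_lip (sa_rep p) x x0; rewrite -!/(pdiag _ _).
by move: h; rewrite zE; have := d0 x x0; have := d0 x0 x; rewrite /pdiag; lra.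
Qed.

Lemma EMc_le1 (p : EMc) : (p <= EMc1)%O.
Proof.
apply/eqP/EMc_eqP; apply: beq_trans (pdiag_meet _ _) _.
have e := @pdiagE EMc1 one_metric erefl.
apply: beq_trans (beq_max (beq_refl _) (beq_sym e)) _.
have oE x : diag one_metric x = 1.
  by rewrite /diag; change (dX x x + 1 = 1); rewrite /dX mdistxx add0r.
split=> r; first by exists r => x; rewrite ge_max => /andP[].
by exists (Num.max r 1) => x h; rewrite ge_max !le_max h oE lexx orbT.
Qed.

HB.instance Definition _ := isPointed.Build EMc EMc1.

(* The points of the Stone space. The library's {tblmorphism E -> bool} does
   not require the compatibility with meets and joins. *)
Record stone := Stone {
  stone_val :> {lmorphism EMc -> bool};
  stone0 : forall x0, stone_val (EMc0 x0) = false;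
  stone1 : stone_val EMc1 = true }.

HB.instance Definition _ := gen_eqMixin stone.
HB.instance Definition _ := gen_choiceMixin stone.

HB.instance Definition _ := @isSubBaseTopological.Build stone
  (EMc * bool)%type setT (fun ei => [set phi : stone | phi ei.1 = ei.2]).

Definition free_ultrafilter (w : set_system X) : Prop :=
  UltraFilter w /\ \bigcap_(A in w) A = set0.

Definition sublevel (d : cmetric) (n : nat) : set X := [set x | diag d x <= n%:R].

(* The limit is that of [tau_cvg], for any selfadjoint representative of s. *)
Definition tau (w : set_system X) (s : EMc) : bool :=
  lim ((fun n => `[< w (sublevel (sa_rep s) n) >]) @ \oo).

End CoarseMetrics.

Section Tau.
Context {R : realType} {X : metricType R} (w : set_system X).
Hypothesis wU : UltraFilter w.

Lemma tau_cvg_aux (d : cmetric X) :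
  (fun n => `[< w (sublevel d n) >]) @ \oo -->
  `[< exists r : R, w [set x | diag d x <= r] >].
Proof.
have mono (r r' : R) : r <= r' ->
    w [set x | diag d x <= r] -> w [set x | diag d x <= r'].
  by move=> rr; apply: filterS => x /= /le_trans; apply.
apply: cvg_near_cst; case: asboolP => [[r hr]|h].
  near=> n; apply/asboolT; apply: mono hr; near: n; exact: nbhs_infty_ger.
by near=> n; apply/asboolF => hn; apply: h; exists n%:R.
Unshelve. all: by end_near. Qed.

Lemma tauE s : tau w s = `[< exists r : R, w [set x | pdiag s x <= r] >].
Proof. apply: cvg_lim; [exact: discrete_hausdorff|exact: tau_cvg_aux]. Qed.

Lemma beq_ultra (f g : X -> R) : beq f g ->
  `[< exists r : R, w [set x | f x <= r] >] =
  `[< exists r : R, w [set x | g x <= r] >].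
Proof.
have half a b : bounds a b -> (exists r : R, w [set x | a x <= r]) ->
    exists r : R, w [set x | b x <= r].
  by move=> ab [r hr]; have [s hs] := ab r; exists s; apply: filterS hr => x /hs.
by move=> [fg gf]; apply/asbool_equiv_eq; split; exact: half.
Qed.

Lemma tau_cvg (s : EMc X) (d : cmetric X) : selfadjoint d -> cclass d = s ->
  (fun n => `[< w (sublevel d n) >]) @ \oo --> tau w s.
Proof.
by move=> _ h; rewrite tauE -(beq_ultra (pdiagE h)); exact: tau_cvg_aux.
Qed.

Lemma tau_meet (p q : EMc X) : tau w (p `&` q)%O = tau w p && tau w q.
Proof.
rewrite !tauE (beq_ultra (pdiag_meet p q)); apply/asboolP/andP.
  by move=> [r hr]; split; apply/asboolP; exists r; apply: filterS hr => x /=;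
    rewrite ge_max => /andP[].
move=> [/asboolP[r hr] /asboolP[s hs]]; exists (Num.max r s).
apply: filterS (filterI hr hs) => x /= [pr qs].
by rewrite ge_max !le_max pr qs orbT.
Qed.

Lemma tau_join (p q : EMc X) : tau w (p `|` q)%O = tau w p || tau w q.
Proof.
rewrite !tauE (beq_ultra (pdiag_join p q)); apply/asboolP/orP.
  move=> [r hr]; have [hp|hp] := in_ultra_setVsetC [set x | pdiag p x <= r] wU.
    by left; apply/asboolP; exists r.
  right; apply/asboolP; exists r; apply: filterS (filterI hr hp) => x /= [].
  by rewrite ge_min => /orP[].
by case=> /asboolP[r hr]; exists r; apply: filterS hr => x /=;
  rewrite ge_min => ->; rewrite ?orbT.
Qed.

Lemma tau1 : tau w (EMc1 X) = true.
Proof.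
rewrite tauE -(beq_ultra (pdiagE (erefl : cclass (one_metric X) = EMc1 X))).
apply/asboolP; exists 1; apply: filterS filterT => x _ /=.
by change (mdist x x + 1 <= 1 :> R); rewrite mdistxx add0r.
Qed.

Lemma tau0 (x0 : X) : (forall x : X, open [set x]) ->
  (forall (x : X) r, compact [set y | mdist x y <= r]) ->
  \bigcap_(A in w) A = set0 -> tau w (EMc0 x0) = false.
Proof.
move=> disc prop free.
rewrite tauE -(beq_ultra (pdiagE (erefl : cclass (zero_metric x0) = EMc0 x0))).
apply/asboolF => -[r hr].
have wB : w [set y | mdist x0 y <= r].
  apply: filterS hr => x /= h; apply: le_trans h.
  change (mdist x0 x <= mdist x x0 + 1 + mdist x0 x).
  by have := mdist_ge0 x x0; lra.
have : compact [set y | mdist x0 y <= r] by exact: prop.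
rewrite compact_ultra => /(_ w wU wB)[p [_ wp]].
suff : (\bigcap_(A in w) A) p by rewrite free.
move=> A wA; have wp1 : w [set p] by apply: wp; exact: open_nbhs_nbhs.
by have [_ [-> Ap]] := filter_ex (filterI wp1 wA).
Qed.

End Tau.

Lemma tau_stone (R : realType) (X : metricType R) (w : set_system X) :
  (forall x : X, open [set x]) ->
  (forall (x : X) r, compact [set y | mdist x y <= r]) ->
  free_ultrafilter w -> exists phi : stone X, phi =1 tau w.
Proof.
move=> disc prop [wU free].
pose f : EMc X -> bool := tau w.
have fI : {morph f : p q / (p `&` q)%O >-> (p `&` q)%O} by exact: tau_meet.
have fU : {morph f : p q / (p `|` q)%O >-> (p `|` q)%O} by exact: tau_join.
have fm : {homo f : p q / (p <= q)%O >-> (p <= q)%O}.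
  by move=> p q /meet_idPl h; apply/meet_idPl; rewrite -fI h.
pose om := Order.isOrderMorphism.Build _ _ _ _ f fm.
pose F0 : {omorphism EMc X -> bool} := HB.pack f om.
pose lm := Order.isLatticeMorphism.Build _ _ _ _ (F0 : EMc X -> bool) fI fU.
pose F : {lmorphism EMc X -> bool} := HB.pack f om lm.
by exists (@Stone _ _ F (fun x0 => tau0 wU x0 disc prop free) (tau1 wU)).
Qed.

(* Main.v *)
Require Import Defs.
From mathcomp Require Import all_boot all_order all_algebra.
From mathcomp Require Import all_classical all_reals all_analysis.

Import Order.TTheory GRing.Theory Num.Theory.
Local Open Scope classical_set_scope.
Local Open Scope ring_scope.

(** Write f and g for the functions x |-> d(x, x') of two idempotents p and q,
    which their coarse equivalence classes determine.  Then p <= q says exactly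
    that g is bounded on every set where f is bounded ([EMc_le_bounds]).

    A basic open set of the Stone space prescribes finitely many values.  If
    it contains a homomorphism phi, let p be the meet of the idempotents with
    prescribed value 1 and q the join of those with prescribed value 0
    ([prescribed_sandwich]).  Then phi(p) = 1 and phi(q) = 0, so p <= q fails:
    there is r such that g takes arbitrarily large values on {f <= r}.  The
    sets {f <= r, g > s}, with r fixed and s varying, therefore generate a
    proper filter, and any ultrafilter w that refines it has tau_w(p) = 1 and
    tau_w(q) = 0 ([separating_ultrafilter]).  It is free, since {g > g(x)} is
    in w and misses x; balls being finite, tau_w is thus a point of the Stone
    space ([tau_stone]).  As tau_w is monotone, it takes all the prescribed
    values. *)

(** With f and g the functions of p and q, the function of the meet is
    max(f, g), and it is coarse equivalent to f as soon as f bounds g, because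
    f <= max(f, g) always holds. *)
Lemma EMc_le_bounds {R : realType} {X : metricType R} {p q : EMc X} :
  (p <= q)%O <-> bounds (pdiag p) (pdiag q).
Proof.
have meet_max : beq (pdiag (p `&` q)%O) (fun x => Num.max (pdiag p x) (pdiag q x)).
  exact: pdiag_meet.
split=> [/meet_idPl pq|pq].
  move: meet_max; rewrite pq => -[pmax _] r; have [s hs] := pmax r.
  by exists s => x /hs; rewrite ge_max => /andP[].
apply/meet_idPl/EMc_eqP; apply: beq_trans meet_max _; split=> r.
  by exists r => x; rewrite ge_max => /andP[].
have [s hs] := pq r; exists (Num.max r s) => x fr.
by rewrite ge_max !le_max fr hs ?orbT.
Qed.

(** The topology is generated by the conditions phi(e) = i, so a neighbourhood
    contains the solutions of finitely many of them. *)
Lemma stone_open_prescribed {R : realType} {X : metricType R}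
    {O : set (stone X)} {phi : stone X} : open O -> O phi ->
  exists2 l : seq (EMc X * bool), (forall ei, ei \in l -> phi ei.1 = ei.2) &
    forall psi : stone X, (forall ei, ei \in l -> psi ei.1 = ei.2) -> O psi.
Proof.
move=> [B BfinI <-] [A BA Aphi]; have [l _ lA] := BfinI _ BA.
have AE (psi : stone X) : (A : set (stone X)) psi =
    (forall ei : EMc X * bool, ei \in finmap.enum_fset l -> psi ei.1 = ei.2).
  by rewrite -lA.
exists (finmap.enum_fset l); first by rewrite -AE.
by move=> psi; rewrite -AE => Apsi; exists A.
Qed.

Lemma stone_homo {R : realType} {X : metricType R} (phi : stone X) (p q : EMc X) :
  (p <= q)%O -> phi p -> phi q.
Proof.
move=> pq; have : (phi p <= phi q)%N by exact: (omorph_le phi pq).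
by case: (phi p); case: (phi q).
Qed.

(** The two idempotents p and q carry all the information of the list: a
    homomorphism that sends p to 1 and q to 0 takes every prescribed value. *)
Lemma prescribed_sandwich {R : realType} {X : metricType R} (x0 : X)
    {phi : stone X} {l : seq (EMc X * bool)} :
    (forall ei, ei \in l -> phi ei.1 = ei.2) ->
  exists p q, [/\ phi p, ~~ phi q &
    forall ei, ei \in l -> if ei.2 then (p <= ei.1)%O else (ei.1 <= q)%O].
Proof.
elim: l => [|[e i] l IHl] phil.
  by exists (EMc1 X), (EMc0 x0); rewrite stone0 stone1.
have [|p [q [phip phiq pql]]] := IHl.
  by move=> ei lei; apply: phil; rewrite inE lei orbT.
have /= phie := phil (e, i) (mem_head _ _).
case: i phie phil => phie _.
  exists (p `&` e)%O, q; split=> //; first by rewrite omorphI /= phip phie.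
  move=> ei; rewrite inE => /predU1P[->/=|/pql]; first exact: leIr.
  by case: ifP => // _; apply: le_trans; exact: leIl.
exists p, (q `|` e)%O; split=> //; first by rewrite omorphU /= negb_or phiq phie.
move=> ei; rewrite inE => /predU1P[->/=|/pql]; first exact: leUr.
by case: ifP => // _ /le_trans; apply; exact: leUl.
Qed.

(** Freeness comes with the separation: the values of [pdiag q] tend to
    infinity along the ultrafilter, so that no point is in all its sets. *)
Lemma separating_ultrafilter {R : realType} {X : metricType R} {p q : EMc X} :
  ~ (p <= q)%O ->
  exists2 w : set_system X, free_ultrafilter w & tau w p /\ ~~ tau w q.
Proof.
move=> /EMc_le_bounds/existsNP[r /forallNP unbounded].
pose F s := [set x | pdiag p x <= r /\ s < pdiag q x].
have F0 s : F s !=set0.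
  have /existsNP[x /not_implyP[xr /negP]] := unbounded s.
  by rewrite -ltNge => sx; exists x.
have PF : ProperFilter (filter_from [set: R] F).
  apply: filter_from_proper => //; apply: filter_from_filter; first by exists 0.
  move=> s t _ _; exists (Num.max s t) => // x [xr].
  by rewrite gt_max => /andP[].
have [w [wU Fw]] := ultraFilterLemma PF.
have wF s : w (F s) by apply: Fw; exists s.
exists w; [split=> //|split].
- rewrite -subset0 => x /(_ _ (wF (pdiag q x)))[_ /=].
  by rewrite ltxx.
- by rewrite tauE; apply/asboolP; exists r; apply: filterS (wF 0) => x [].
- rewrite tauE; apply/asboolPn => -[s ws].
  have [x [/= xs [_]]] := filter_ex (filterI ws (wF s)).
  by rewrite ltNge xs.
Qed.

Theorem theorem6p4 (R : realType) (X : metricType R)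
  (X_infinite : infinite_set [set: X])
  (X_discrete : forall x : X, open [set x])
  (X_proper : forall (x : X) (r : R), compact [set y : X | mdist x y <= r]) :
  dense [set phi : stone X |
         exists2 w : set_system X, free_ultrafilter w & phi =1 tau w].
Proof.
move=> O [phi Ophi] openO.
have [x0 _] := infinite_setN0 X_infinite.
have [l phil lO] := stone_open_prescribed openO Ophi.
have [p [q [phip phiq pql]]] := prescribed_sandwich x0 phil.
have npq : ~ (p <= q)%O.
  by move=> /(stone_homo phi)/(_ phip); apply/negP.
have [w wfree [wp wq]] := separating_ultrafilter npq.
have [psi psiE] := tau_stone X_discrete X_proper wfree.
exists psi; split; last by exists w.
rewrite -!psiE in wp wq.
apply: lO => -[e [] /pql/= /(stone_homo psi)]; first exact.
by case: (psi e) => // /(_ isT); rewrite (negbTE wq).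
Qed.
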